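(* Let $(\mathfrak{D},\preceq,\bot,\top)$ be a system model, let $\mathbf{T}=(T,\alpha)$ be a test setup for it, and let $R\subseteq\mathfrak{D}$ be a requirement. If $R$ is $\mathbf{T}$-refutable, then $R$ is a prohibition.
   Context: A system model is a tuple $(\mathfrak{D},\preceq,\bot,\top)$ where $\mathfrak{D}$ is a nonempty set (of systems), $\preceq$ is a partial order on $\mathfrak{D}$ (refinement: $S_1\preceq S_2$ means $S_1$ refines $S_2$, equivalently $S_2$ abstracts $S_1$), $\bot$ is the least element and $\top$ the greatest element. A requirement is a subset $R\subseteq\mathfrak{D}$; a system $S$ satisfies $R$ if $S\in R$, and violates it otherwise. A requirement $R$ is a prohibition if it is refinement-closed: for all $S,S'\in\mathfrak{D}$, $S\in R$ and $S'\preceq S$ imply $S'\in R$. A test setup is a pair $\mathbf{T}=(T,\alpha)$ where $T$ is a set (of observations) and $\alpha:\mathfrak{D}\to 2^T$ is order-preserving: $S\preceq S'$ implies $\alpha(S)\subseteq\alpha(S')$. For $t\in T$, $\hat\alpha(t)=\{S\in\mathfrak{D}\mid t\in\alpha(S)\}$. A requirement $R$ is $\mathbf{T}$-refutable if for every $S\in\mathfrak{D}$ with $S\notin R$ there exists $t\in\alpha(S)$ with $\hat\alpha(t)\cap R=\emptyset$. *)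

(* Defs.v *)
(* A system model (D, <=, \bot, \top) is a [D : tbPOrderType d]; nonemptiness
   is witnessed by \bot. With the axioms of boolp, every type carries a choice
   structure and every partial order is boolean-valued, so this covers
   arbitrary system models. A requirement is a [R : set D]. *)
From mathcomp Require Import all_boot all_order.
From mathcomp Require Import boolp classical_sets.

Set Implicit Arguments.
Unset Strict Implicit.
Unset Printing Implicit Defensive.

Import Order.TTheory.
Local Open Scope order_scope.
(* Opened last so that [`&`] is set intersection, not the lattice meet. *)
Local Open Scope classical_set_scope.

(* [S' <= S] reads "S' refines S". *)
Definition prohibition (d : Order.disp_t) (D : tbPOrderType d) (R : set D)
  : Prop :=
  forall S S' : D, R S -> S' <= S -> R S'.

Record test_setup (d : Order.disp_t) (D : tbPOrderType d) := TestSetup {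
  obs : Type;
  alpha : D -> set obs;
  alpha_homo : {homo alpha : S S' / S <= S' >-> S `<=` S'}
}.
Arguments alpha {d D} t _.

Definition alpha_hat (d : Order.disp_t) (D : tbPOrderType d)
    (T : test_setup D) (t : obs T) : set D :=
  [set S | alpha T S t].

Definition refutable (d : Order.disp_t) (D : tbPOrderType d)
    (T : test_setup D) (R : set D) : Prop :=
  forall S : D, ~ R S ->
    exists2 t : obs T, alpha T S t & alpha_hat t `&` R = set0.

(* Main.v *)
Require Import Defs.
From mathcomp Require Import all_boot all_order.
From mathcomp Require Import boolp classical_sets.

Theorem theorem1 (d : Order.disp_t) (D : tbPOrderType d)
    (T : test_setup D) (R : set D) :
  refutable T R -> prohibition R.
Proof.
(* By contradiction: if [S'] violated [R], refutability would give an observation [t] of [S'] that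
   no system satisfying [R] can produce. *)
move=> refR S S' RS leS'S; apply: contrapT => /refR [t tS' disj].
(* A refuting observation of [S'] is also one of its abstraction [S]. *)
have tS : alpha T S t by exact: (@alpha_homo _ _ T _ _ leS'S).
(* Reading [disj] backwards turns membership of [S] in the empty set into the conjunction of [tS]
   and [RS]: [S] satisfies [R] and yet exhibits [t], which is absurd. *)
by have : set0 S by rewrite -disj.
Qed.
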